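(* Let $H$ be a Krull monoid, $\varphi:H\to F=\mathcal F(P)$ a cofinal divisor homomorphism, $G=\mathcal C(\varphi)$ its class group, which is finite with $|G|>1$, and $G_P\subset G$ the set of classes containing prime divisors. If $\exp(G)=n$ and $\mathsf r(G)=r$, then, writing $m=\lfloor n/2\rfloor$ and $k=\lfloor\log_{m+1}|G|\rfloor$, $$\daleth(H)\le\max\Big\{n,\ \tfrac23\mathsf D(G_P)+\tfrac13\big\lfloor k\cdot m+|G|\cdot(m+1)^{-k}\big\rfloor\Big\}\le\max\Big\{n,\ \tfrac13\big(2\mathsf D(G_P)+\tfrac12 rn+2^r\big)\Big\}.$$
   Context: A monoid is a commutative cancellative semigroup with identity. $H$ is a Krull monoid if $H/H^\times$ is a saturated submonoid of a free abelian monoid. A monoid homomorphism $\varphi:H\to D$ is a divisor homomorphism if $\varphi(a)\mid\varphi(b)$ implies $a\mid b$, and cofinal if every $a\in D$ divides some $\varphi(u)$. For $\varphi:H\to\mathcal F(P)$ (free abelian monoid on $P$), $\mathcal C(\varphi)=\mathsf q(\mathcal F(P))/\mathsf q(\varphi(H))$ (additive), and $G_P=\{[p]\mid p\in P\}$. For a finite abelian group $G\cong C_{n_1}\oplus\dots\oplus C_{n_r}$ with $1<n_1\mid\dots\mid n_r$, $\mathsf r(G)=r$ is its rank and $\exp(G)=n_r$. $\mathsf D(G_P)$ is the maximal length of a minimal zero-sum sequence over $G_P$ (a nonempty finite multiset of elements of $G_P$ summing to $0$ with no proper nonempty zero-sum sub-multiset). For an atomic monoid $H$ and $a\in H$, $\mathsf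 L(a)$ is the set of lengths of factorizations of $a$ into atoms, and $\daleth(H)=\sup\{\min(\mathsf L(uv)\setminus\{2\})\mid u,v\text{ atoms of }H\}$, with $\min\emptyset=\sup\emptyset=0$. *)

(* Defs.v *)
From HB Require Import structures.
From mathcomp Require Import all_boot all_order all_algebra.
From mathcomp Require Import generic_quotient ring_quotient.
From mathcomp Require Import finmap multiset.
From mathcomp Require Import all_classical all_reals.
From mathcomp Require Import ereal.

Set Implicit Arguments.
Unset Strict Implicit.
Unset Printing Implicit Defensive.

Import Order.TTheory GRing.Theory Num.Theory.

Local Open Scope quotient_scope.
Local Open Scope classical_set_scope.
Local Open Scope ring_scope.

(* Commutative cancellative monoids are written additively, so that products
   of the multiplicative theory become sums and 1 becomes 0. *)
HB.mixin Record Nmodule_isCancellative M of GRing.Nmodule M := {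
  addmI : right_injective (@GRing.add M)
}.

#[short(type="cmonoidType")]
HB.structure Definition CMonoid :=
  {M of GRing.Nmodule M & Nmodule_isCancellative M}.

Section Divisibility.
Variable M : nmodType.
Implicit Types a b c u : M.

Definition divides a b := exists c, b = a + c.

Definition is_unit a := exists b, a + b = 0.

Definition associated a b := `[< exists2 u, is_unit u & b = a + u >].

Lemma associated_refl : reflexive associated.
Proof. by move=> a; apply/asboolP; exists 0; [exists 0|]; rewrite addr0. Qed.

Lemma associated_sym : symmetric associated.
Proof.
suff H a b : associated a b -> associated b a by move=> a b; apply/idP/idP => /H.
move=> /asboolP[u [v uv] ->]; apply/asboolP; exists v.
  by exists u; rewrite addrC.
by rewrite -addrA uv addr0.
Qed.

Lemma associated_trans : transitive associated.
Proof.
move=> b a c /asboolP[u [u' uu'] ->] /asboolP[v [v' vv'] ->].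
apply/asboolP; exists (u + v); last by rewrite addrA.
by exists (u' + v'); rewrite addrACA uu' vv' addr0.
Qed.

Canonical associated_equiv :=
  EquivRel associated associated_refl associated_sym associated_trans.

Lemma associatedD a a' b b' :
  associated a a' -> associated b b' -> associated (a + b) (a' + b').
Proof.
move=> /asboolP[u [u' uu'] ->] /asboolP[v [v' vv'] ->]; apply/asboolP.
exists (u + v); last by rewrite addrACA.
by exists (u' + v'); rewrite addrACA uu' vv' addr0.
Qed.

(* the quotient of M by its group of units *)
Definition reduced := {eq_quot associated}.

HB.instance Definition _ : EqQuotient M associated reduced :=
  EqQuotient.on reduced.
HB.instance Definition _ := Choice.on reduced.

Definition reduced_zero : reduced := lift_cst reduced 0.
Definition reduced_add := lift_op2 reduced +%R.

Canonical pi_reduced_zero := PiConst reduced_zero.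

Lemma pi_reduced_addE : {morph \pi : a b / a + b >-> reduced_add a b}.
Proof.
move=> a b /=; unlock reduced_add; apply/eqP; rewrite piE.
by apply: associatedD; apply/eqmodP; rewrite reprK.
Qed.
Canonical pi_reduced_add := PiMorph2 pi_reduced_addE.

Fact reduced_addA : associative reduced_add.
Proof. by move=> x y z; rewrite -[x]reprK -[y]reprK -[z]reprK !piE addrA. Qed.

Fact reduced_addC : commutative reduced_add.
Proof. by move=> x y; rewrite -[x]reprK -[y]reprK !piE addrC. Qed.

Fact reduced_add0 : left_id reduced_zero reduced_add.
Proof. by move=> x; rewrite -[x]reprK !piE add0r. Qed.

HB.instance Definition _ :=
  GRing.isNmodule.Build reduced reduced_addA reduced_addC reduced_add0.

End Divisibility.

Definition divisor_hom (M D : nmodType) (f : M -> D) :=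
  forall a b, divides (f a) (f b) -> divides a b.

Definition cofinal_hom (M D : nmodType) (f : M -> D) :=
  forall d, exists a, divides d (f a).

(* T is saturated in D if divisibility in T is the restriction of divisibility
   in D. *)
Definition saturated_submonoid (D : nmodType) (T : set D) :=
  [/\ T 0, forall a b, T a -> T b -> T (a + b) &
      forall a b, T a -> T b -> divides a b -> exists2 c, T c & b = a + c].

Definition free_monoid (P : choiceType) := {mset P}%mset.

Section FreeMonoid.
Variable P : choiceType.

HB.instance Definition _ := Choice.on (free_monoid P).
HB.instance Definition _ := GRing.isNmodule.Build (free_monoid P)
  (@msetDA P) (@msetDC P) (@mset0D P).

Fact free_monoid_addI : right_injective (@GRing.add (free_monoid P)).
Proof. by move=> A; apply: can_inj (msetDKB A). Qed.

HB.instance Definition _ :=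
  Nmodule_isCancellative.Build (free_monoid P) free_monoid_addI.

Definition free_gen (p : P) : free_monoid P := [mset p]%mset.

End FreeMonoid.

Definition krull (H : cmonoidType) :=
  exists (Q : choiceType) (f : {additive reduced H -> free_monoid Q}),
    injective f /\ saturated_submonoid (range f).

Section QuotientGroup.
Variable M : cmonoidType.

(* (a, b) stands for the formal difference a - b *)
Definition diff_eq (x y : M * M) := x.1 + y.2 == y.1 + x.2.

Lemma diff_eq_refl : reflexive diff_eq.
Proof. by move=> x; apply: eqxx. Qed.

Lemma diff_eq_sym : symmetric diff_eq.
Proof. by move=> x y; rewrite /diff_eq eq_sym. Qed.

Lemma diff_eq_trans : transitive diff_eq.
Proof.
move=> [b b'] [a a'] [c c']; rewrite /diff_eq /= => /eqP ab /eqP bc; apply/eqP.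
apply: (@addmI M b'); rewrite addrA [b' + a]addrC ab addrAC bc.
by rewrite [c + b']addrC -addrA.
Qed.

Canonical diff_eq_equiv := EquivRel diff_eq diff_eq_refl diff_eq_sym diff_eq_trans.

Definition qgroup := {eq_quot diff_eq}.

HB.instance Definition _ : EqQuotient (M * M)%type diff_eq qgroup :=
  EqQuotient.on qgroup.
HB.instance Definition _ := Choice.on qgroup.

Definition qadd_pair (x y : M * M) := (x.1 + y.1, x.2 + y.2).
Definition qopp_pair (x : M * M) := (x.2, x.1).

Definition qzero : qgroup := lift_cst qgroup (0, 0).
Definition qadd := lift_op2 qgroup qadd_pair.
Definition qopp := lift_op1 qgroup qopp_pair.

Canonical pi_qzero := PiConst qzero.

Lemma pi_qaddE : {morph \pi : x y / qadd_pair x y >-> qadd x y}.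
Proof.
move=> x y /=; unlock qadd; apply/eqP; rewrite piE /diff_eq /=.
have /eqmodP/eqP ex := esym (reprK (\pi_qgroup x)).
have /eqmodP/eqP ey := esym (reprK (\pi_qgroup y)).
by rewrite addrACA ex ey addrACA.
Qed.
Canonical pi_qadd := PiMorph2 pi_qaddE.

Lemma pi_qoppE : {morph \pi : x / qopp_pair x >-> qopp x}.
Proof.
move=> x /=; unlock qopp; apply/eqP; rewrite piE /diff_eq /=.
have /eqmodP/eqP ex := esym (reprK (\pi_qgroup x)).
by rewrite addrC -ex addrC.
Qed.
Canonical pi_qopp := PiMorph1 pi_qoppE.

Fact qaddA : associative qadd.
Proof.
move=> x y z; rewrite -[x]reprK -[y]reprK -[z]reprK !piE.
by rewrite /qadd_pair /= !addrA.
Qed.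

Fact qaddC : commutative qadd.
Proof.
move=> x y; rewrite -[x]reprK -[y]reprK !piE /qadd_pair.
by rewrite addrC [(repr x).2 + _]addrC.
Qed.

Fact qadd0 : left_id qzero qadd.
Proof.
by move=> x; rewrite -[x]reprK !piE /qadd_pair !add0r -surjective_pairing.
Qed.

Fact qaddN : left_inverse qzero qopp qadd.
Proof.
move=> x; rewrite -[x]reprK !piE; apply/eqP; rewrite piE /diff_eq /=.
by rewrite addr0 add0r addrC.
Qed.

HB.instance Definition _ := GRing.isZmodule.Build qgroup qaddA qaddC qadd0 qaddN.

Definition qdiff (a b : M) : qgroup := \pi_qgroup (a, b).

Lemma qdiff0 a : qdiff a a = 0.
Proof. by apply/eqP; rewrite /qdiff piE /diff_eq /= addr0 add0r. Qed.

Lemma qdiffB a b c d : qdiff a b - qdiff c d = qdiff (a + d) (b + c).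
Proof. by rewrite /qdiff !piE. Qed.

End QuotientGroup.

Section ClassGroup.
Variables (H : cmonoidType) (P : choiceType) (phi : {additive H -> free_monoid P}).

(* q(phi(H)), as a subgroup of q(F(P)) *)
Definition principal : {pred qgroup (free_monoid P)} :=
  fun x => `[< exists a b, x = qdiff (phi a) (phi b) >].

Fact principal_zmod_closed : zmod_closed principal.
Proof.
split=> [|x y]; first by apply/asboolP; exists 0, 0; rewrite qdiff0.
move=> /asboolP[a [b ->]] /asboolP[c [d ->]]; apply/asboolP.
by exists (a + d), (b + c); rewrite qdiffB !raddfD.
Qed.

HB.instance Definition _ :=
  GRing.isZmodClosed.Build (qgroup (free_monoid P)) principal
    principal_zmod_closed.

Definition class_group : zmodType := Quotient.quot principal.

Definition class_of (x : free_monoid P) : class_group :=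
  \pi_(Quotient.quot principal) (qdiff x 0).

Definition prime_classes : set class_group :=
  range (fun p => class_of (free_gen p)).

End ClassGroup.

Arguments prime_classes {H P} phi _.

(* G is isomorphic to C_(n_1) (+) ... (+) C_(n_r) with 1 < n_1 | ... | n_r; a
   homomorphism into the direct sum is given by its r components. *)
Definition invariant_factors (G : zmodType) (ns : seq nat) :=
  [/\ all (ltn 1) ns, sorted dvdn ns &
      exists f : forall i : 'I_(size ns), {additive G -> 'Z_(nth 0%N ns i)},
        bijective (fun g i => f i g)].

Definition has_rank (G : zmodType) (r : nat) :=
  exists2 ns, invariant_factors G ns & size ns = r.

Definition has_exponent (G : zmodType) (n : nat) :=
  exists2 ns, invariant_factors G ns & last 1%N ns = n.

(* 0 if A is empty, resp. if A has no maximum *)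
Definition set_min (A : set nat) : nat :=
  xget 0%N [set k | A k /\ forall j, A j -> (k <= j)%N].
Definition set_max (A : set nat) : nat :=
  xget 0%N [set k | A k /\ forall j, A j -> (j <= k)%N].

Definition minimal_zero_sum (G : zmodType) (G0 : set G) (S : {mset G}%mset) :=
  [/\ S <> mset0, forall g, g \in S -> G0 g, \sum_(g <- S) g = 0 &
      forall T : {mset G}%mset,
        T <> mset0 -> mproper T S -> \sum_(g <- T) g <> 0].

(* The maximum exists whenever G is finite and G0 is nonempty. *)
Definition davenport (G : zmodType) (G0 : set G) : nat :=
  set_max [set size S | S in minimal_zero_sum G0].

Section Lengths.
Variable H : cmonoidType.

Definition atom (u : H) :=
  ~ is_unit u /\ forall a b, u = a + b -> is_unit a \/ is_unit b.

(* Factorizations are taken up to units, so that the lengths of a unit form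
   the set {0}. *)
Definition lengths (a : H) : set nat :=
  [set k | exists2 s : seq H, forall u, u \in s -> atom u &
           associated a (\sum_(u <- s) u) /\ size s = k].

(* The supremum may be infinite; adjoining 0 to the set of values, all of
   which are nonnegative, implements sup(empty) = 0. *)
Definition daleth (R : realType) : \bar R :=
  ereal_sup [set (k%:R : R)%:E | k in
    0%N |` [set set_min (lengths (uv.1 + uv.2) `\ 2%N)
           | uv in [set uv : H * H | atom uv.1 /\ atom uv.2]]].

End Lengths.

(* Main.v *)
Require Import Defs.
From HB Require Import structures.
From mathcomp Require Import all_boot all_order all_algebra.
From mathcomp Require Import generic_quotient ring_quotient.
From mathcomp Require Import finmap multiset.
From mathcomp Require Import all_classical all_reals.
From mathcomp Require Import ereal.
From mathcomp Require Import zify ring lra.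

Set Implicit Arguments.
Unset Strict Implicit.
Unset Printing Implicit Defensive.

Import Order.TTheory GRing.Theory Num.Theory.

Local Open Scope classical_set_scope.
Local Open Scope ring_scope.

(* Under [phi], atoms of [H] become minimal zero-sum elements of the free
   monoid, of length at most [D].  Let [U], [V] be two of them and consider a
   shortest factorization of [U + V] among those of length [l >= 3].  Each
   factor meets both [U] and [V], so it has length at least 2, and if [j] of
   the factors have length 2 then [3 l <= 2 D + j].  The factors of length 2
   are of the form [p + q] with [p] in [U], [q] in [V] and [[q] = - [p]].
   - If more than [m = n / 2] of them have the same class [[p] = g], then
     regrouping around [n g = 0] produces a factorization of length between
     3 and [n], so [l <= n].
   - Otherwise, if [j > K m + N / (m + 1) ^ K] with [N = |G|], then all but
     one of these factors have more than [N] sub-multisets of classes, so two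
     of them have the same sum.  After cancellation there are disjoint sets
     [I], [J] of factors with the same class sum, and exchanging the [V]-parts
     of [I] and [J] yields a shorter factorization, a contradiction.
   The second inequality holds since [K = trunc_log (m + 1) N] minimizes
   [K m + N / (m + 1) ^ K], since [N <= n ^ r] and since [n <= 2 (m + 1)]. *)

(** * Lengths and common refinements in a free monoid *)

Section Length.
Variable P : choiceType.
Implicit Types x y z w : free_monoid P.

Definition len x : nat := size (enum_mset x).

Lemma perm_enum_msetD (K : choiceType) (A B : {mset K}%mset) :
  perm_eq (msetD A B) (A ++ B).
Proof.
rewrite /perm_eq; apply/allP => a _ /=.
by rewrite count_cat !count_mem_mset msetE2.
Qed.

Lemma len0 : len 0 = 0%N.
Proof. by rewrite /len enum_mset0. Qed.

Lemma lenD x y : len (x + y) = (len x + len y)%N.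
Proof. by rewrite /len (perm_size (perm_enum_msetD x y)) size_cat. Qed.

Lemma len_eq0 x : (len x == 0%N) = (x == 0).
Proof. exact: size_mset_eq0. Qed.

Lemma len_gt0 x : (0 < len x)%N = (x != 0).
Proof. by rewrite lt0n len_eq0. Qed.

Lemma len_sum I (s : seq I) (F : I -> free_monoid P) :
  len (\sum_(i <- s) F i) = (\sum_(i <- s) len (F i))%N.
Proof. by apply: (big_morph len lenD len0). Qed.

Lemma fm_addI x y z : x + y = x + z -> y = z.
Proof. exact: addmI. Qed.

Lemma free_monoid_refinement w x y z :
  w + x = y + z ->
  exists a b y' z', [/\ w = a + b, y = a + y', z = b + z' & x = y' + z'].
Proof.
move=> e; have E p : ((w : {mset P}%mset) p + (x : {mset P}%mset) p =
    (y : {mset P}%mset) p + (z : {mset P}%mset) p)%N.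
  by have /(congr1 (fun f : {mset P}%mset => f p)) := e; rewrite !msetE2.
(* The common part [a] is the intersection of [w] and [y]; the other three pieces are then
   forced. *)
pose a : free_monoid P := msetI w y; pose b : free_monoid P := msetB w a.
exists a, b, (msetB y a), (msetB z b); rewrite /a /b.
by split; apply/msetP => p; rewrite !msetE2; have := E p; lia.
Qed.

Lemma sum_refinement (ws : seq (free_monoid P)) y z :
  \sum_(w <- ws) w = y + z ->
  exists prs : seq (free_monoid P * free_monoid P),
    [/\ ws = [seq t.1 + t.2 | t <- prs],
        \sum_(t <- prs) t.1 = y & \sum_(t <- prs) t.2 = z].
Proof.
elim: ws y z => [|w ws IH] y z.
  rewrite big_nil => /(congr1 len); rewrite len0 lenD => /esym/eqP.
  rewrite addn_eq0 !len_eq0 => /andP[/eqP-> /eqP->].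
  by exists [::]; rewrite !big_nil.
rewrite big_cons => /free_monoid_refinement[a [b [y' [z' [-> -> -> /IH]]]]].
move=> [prs [-> <- <-]]; exists ((a, b) :: prs).
by rewrite !big_cons.
Qed.

(** Elements of length 1 are the generators of the free monoid, and these are prime. *)
Lemma len1_sum (s : seq (free_monoid P)) x :
  (forall w, w \in s -> len w = 1%N) -> len x = 1%N ->
  (exists y, \sum_(w <- s) w = x + y) -> x \in s.
Proof.
move=> s1 x1 [y]; elim: s y s1 => [|w s IH] y s1.
  by rewrite big_nil => /(congr1 len); rewrite len0 lenD x1.
rewrite big_cons => /free_monoid_refinement[a [b [x' [y' [ew ex ey es]]]]].
have w1 : len w = 1%N by apply: s1; rewrite mem_head.
have [a0|a0] := eqVneq a 0.
  rewrite a0 add0r in ex; rewrite -ex in es.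
  rewrite inE (IH _ _ es) ?orbT // => v vs; apply: s1.
  by rewrite inE vs orbT.
have := len_gt0 a; rewrite a0 => la.
have lb : len b = 0%N by move: w1; rewrite ew lenD; lia.
have lx : len x' = 0%N by move: x1; rewrite ex lenD; lia.
move/eqP: lb; rewrite len_eq0 => /eqP b0.
move/eqP: lx; rewrite len_eq0 => /eqP x0.
by rewrite ew ex b0 x0 addr0 mem_head.
Qed.

End Length.

(** * Zero-sum elements of a free monoid and their factorizations *)

Section ZeroSumAtoms.
Variables (P : choiceType) (G : zmodType) (c : {additive free_monoid P -> G}).
Local Notation F := (free_monoid P).
Implicit Types (x y z w : F) (ws : seq F).

(** The atoms of the kernel of [c]: since [c x = 0], the condition [c y = 0] makes [z] zero-sum
    too. *)
Definition zs_atom x :=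
  [/\ x <> 0, c x = 0 & forall y z, x = y + z -> c y = 0 -> y = 0 \/ z = 0].

Definition zs_factor ws x :=
  (forall w, w \in ws -> zs_atom w) /\ \sum_(w <- ws) w = x.

Lemma zs_factor_cat ws ws' x x' :
  zs_factor ws x -> zs_factor ws' x' -> zs_factor (ws ++ ws') (x + x').
Proof.
move=> [h <-] [h' <-]; split; last by rewrite big_cat.
by move=> w; rewrite mem_cat => /orP[/h|/h'].
Qed.

Lemma zs_factor_ex x : c x = 0 -> exists ws, zs_factor ws x.
Proof.
have [k] := ubnP (len x); elim: k x => // k IH x lk cx.
have [->|/eqP x0] := eqVneq x 0; first by exists [::]; split; rewrite ?big_nil.
have [ax|nax] := pselect (zs_atom x).
  by exists [:: x]; split; rewrite ?big_seq1 // => w; rewrite inE => /eqP->.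
have /existsNP[y /existsNP[z /not_implyP[exyz /not_implyP[cy /not_orP[y0 z0]]]]] :
    ~ (forall y z, x = y + z -> c y = 0 -> y = 0 \/ z = 0) by move=> h; apply: nax.
have cz : c z = 0 by move: cx; rewrite exyz raddfD cy add0r.
have ly : (0 < len y)%N by rewrite len_gt0; apply/eqP.
have lz : (0 < len z)%N by rewrite len_gt0; apply/eqP.
move: lk; rewrite exyz lenD => lk.
have [|ws1 f1] := IH y _ cy; first by lia.
have [|ws2 f2] := IH z _ cz; first by lia.
by exists (ws1 ++ ws2); apply: zs_factor_cat.
Qed.

Lemma zs_factor_nil x : zs_factor [::] x -> x = 0.
Proof. by case=> _; rewrite big_nil. Qed.

Lemma zs_atom_factor u ws : zs_atom u -> zs_factor ws u -> size ws = 1%N.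
Proof.
move=> [u0 cu hu] [aws]; case: ws aws => [|w [|w' ws]] aws //.
  by rewrite big_nil => /esym.
rewrite 2!big_cons => /esym e.
have [w0 cw _] : zs_atom w by apply: aws; rewrite !inE eqxx.
have [w'0 _ _] : zs_atom w' by apply: aws; rewrite !inE eqxx orbT.
have [//|/(congr1 (@len P))] := hu _ _ e cw.
have : (0 < len w')%N by rewrite len_gt0; apply/eqP.
by rewrite lenD len0; lia.
Qed.

(* A zero-sum part of an atom is trivial, so a factor of y + z cannot avoid z
   when y is a proper part of an atom. *)
Lemma proper_part_factor u y y' (prs : seq (F * F)) :
  zs_atom u -> u = y + y' -> y' <> 0 ->
  (forall t, t \in prs -> zs_atom (t.1 + t.2)) ->
  \sum_(t <- prs) t.1 = y ->
  forall t, t \in prs -> t.2 != 0.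
Proof.
move=> [u0 cu hu] eu y'0 aprs ey t tprs; apply/eqP => t20.
have := aprs _ tprs; rewrite t20 addr0 => -[t10 ct _].
have ey' : y = t.1 + \sum_(s <- rem t prs) s.1.
  by rewrite -ey (perm_big _ (perm_to_rem tprs)) big_cons.
have [|//|h] := hu t.1 (\sum_(s <- rem t prs) s.1 + y') _ ct.
  by rewrite eu ey' addrA.
have /(congr1 (@len P)) := h; rewrite lenD len0.
have : (0 < len y')%N by rewrite len_gt0; apply/eqP.
lia.
Qed.

Lemma size_le_sum_len (I : eqType) (s : seq I) (f : I -> F) :
  (forall i, i \in s -> f i != 0) -> (size s <= len (\sum_(i <- s) f i)%R)%N.
Proof.
move=> h; rewrite len_sum -sum1_size big_seq [leqRHS]big_seq.
by apply: leq_sum => i /h; rewrite len_gt0.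
Qed.

(** After refinement along [y + z], each factor has a nonzero part in [z] by [proper_part_factor],
    and [z] has room for at most [len z] such parts. *)
Lemma proper_part_factor_size u y y' z ws :
  zs_atom u -> u = y + y' -> y' <> 0 -> zs_factor ws (y + z) ->
  (size ws <= len z)%N.
Proof.
move=> au eu y'0 [aws /sum_refinement[prs [ews ey ez]]].
rewrite ews size_map -ez; apply: size_le_sum_len.
apply: (proper_part_factor au eu y'0 _ ey) => t tprs.
by apply: aws; rewrite ews; apply/mapP; exists t.
Qed.

End ZeroSumAtoms.

(* Both sides are affine in the first entry [v] of the list, so it suffices
   to know the inequality at [v = 0] and at [v = m]. *)
Lemma sum_le_prodS (m K : nat) (I : eqType) (s : seq I) (v : I -> nat) :
  (forall i, i \in s -> (v i <= m)%N) ->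
  ((\sum_(i <- s) v i).+1 * m.+1 ^ K <=
   K * m * m.+1 ^ K + \prod_(i <- s) (v i).+1)%N.
Proof.
elim: s K => [|i s IH] K h.
  rewrite !big_nil mul1n addn1; elim: K => // K.
  by rewrite expnS; move: (m.+1 ^ K)%N => q; nia.
have hs j : j \in s -> (v j <= m)%N by move=> js; apply: h; rewrite inE js orbT.
have hi : (v i <= m)%N by apply: h; rewrite mem_head.
rewrite !big_cons; move: (v i) hi => {h} w wm.
case: K => [|K].
  have := IH 0%N hs; rewrite !mul0n !expn0.
  by set S := (\sum_(_ <- _) _)%N; set X := (\prod_(_ <- _) _)%N; nia.
have := IH K hs; have := IH K.+1 hs.
set S := (\sum_(_ <- _) _)%N; set X := (\prod_(_ <- _) _)%N.
rewrite expnS; set q := (m.+1 ^ K)%N => h1 h0.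
case: (posnP m) => [m0|m0]; first by move: wm h1 h0; rewrite m0 leqn0 => /eqP->; lia.
rewrite -(leq_pmul2l m0).
have [d em] : exists d, m = (w + d)%N by exists (m - w)%N; lia.
have h0' := leq_mul (leqnn (w * m.+1)%N) h0.
have h1' := leq_mul (leqnn d) h1.
move: h0' h1' {h0 h1 IH hs m0 wm}; clearbody S X q; rewrite em.
by lia.
Qed.

(** * Sub-multisets of a list in a finite group and coincidences of their sums *)

Section SubMultisets.
Variables (K : choiceType) (v : K -> nat).

(** For duplicate-free [s], these are the multisets supported in [s] with multiplicities bounded by
    [v]; the recursion mirrors the product that counts them. *)
Fixpoint submsets (s : seq K) : seq {mset K}%mset :=
  if s is g :: s' then
    [seq msetD (msetn k g) e | k <- iota 0 (v g).+1, e <- submsets s']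
  else [:: mset0%mset].

Lemma size_submsets s : size (submsets s) = (\prod_(g <- s) (v g).+1)%N.
Proof.
elim: s => [|g s IH]; first by rewrite big_nil.
rewrite big_cons -IH; apply: etrans (size_allpairs _ _ _) _.
by rewrite size_iota.
Qed.

Lemma submsets_notin s e h : e \in submsets s -> h \notin s -> e h = 0%N.
Proof.
elim: s e => [|g s IH] e.
  by rewrite inE => /eqP->; rewrite mset0E.
move=> /allpairsP[[k f] /= [_ fs ->]]; rewrite inE negb_or => /andP[hg hs].
by rewrite msetE2 msetnE (negPf hg) (IH _ fs hs).
Qed.

Lemma submsets_le s e h : uniq s -> e \in submsets s -> (e h <= v h)%N.
Proof.
elim: s e => [|g s IH] e.
  by rewrite inE => _ /eqP->; rewrite mset0E.
rewrite cons_uniq => /andP[gs us] /allpairsP[[k f] [+ fs ->]].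
rewrite mem_iota add0n ltnS => /andP[_ /= kv]; rewrite msetE2 msetnE /=.
case: eqP => [->|_]; last exact: IH.
by rewrite (submsets_notin fs gs) addn0.
Qed.

Lemma submsets_uniq s : uniq s -> uniq (submsets s).
Proof.
elim: s => [|g s IH] //; rewrite cons_uniq => /andP[gs us].
apply: (@allpairs_uniq _ _ _ _ (iota 0 (v g).+1)); rewrite ?iota_uniq ?IH //.
move=> [k e] [k' e'] /allpairsP[[? ?] [_ es [-> ->]]].
move=> /allpairsP[[? ?] [_ es' [-> ->]]] /= E; rewrite /= in es es'.
have := congr1 (fun f : {mset K}%mset => f g) E.
rewrite !msetE2 !msetnxx (submsets_notin es gs) (submsets_notin es' gs) !addn0.
by move=> ek; rewrite ek in E *; rewrite (can_inj (@msetDKB _ _) E).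
Qed.

End SubMultisets.

Lemma uniq_card_setT (T : choiceType) (s : seq T) :
  finite_set [set: T] -> uniq s -> (size s <= #|` fset_set [set: T]|)%N.
Proof.
move=> fT us; apply: uniq_leq_size => // x _.
by rewrite in_fset_set // in_setT.
Qed.

(** Pigeonhole: by [sum_le_prodS], a list this long with multiplicities at most [m] has more
    sub-multisets than [G] has elements. *)
Lemma disjoint_equal_subsums (G : zmodType) (m K : nat) (s : seq G) :
  finite_set [set: G] -> (forall g, count_mem g s <= m)%N ->
  (#|` fset_set [set: G]| + K * m * m.+1 ^ K < (size s).+1 * m.+1 ^ K)%N ->
  exists d d' r : seq G, [/\ perm_eq s (d ++ d' ++ r),
    forall g, g \in d -> g \notin d',
    (0 < size d + size d')%N & \sum_(g <- d) g = \sum_(g <- d') g].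
Proof.
move=> fG cs hN; pose X := seq_mset s.
have Xs : perm_eq X s by apply: perm_eq_seq_mset.
have XE g : X g = count_mem g s by rewrite mset_seqE.
have := @sum_le_prodS m K _ (finsupp X) X.
rewrite -size_mset (perm_size Xs) => h.
have {}h := h (fun g _ => eq_ind_r (fun k => k <= m)%N (cs g) (XE g)).
have NE : (#|` fset_set [set: G]| < size (submsets X (finsupp X)))%N.
  by rewrite size_submsets -(ltn_add2l (K * m * m.+1 ^ K)) addnC (leq_trans hN).
pose E := submsets X (finsupp X).
have uE : uniq E by apply: submsets_uniq; apply: fset_uniq.
have [inj|] := pselect {in E &, injective (fun e : {mset G}%mset => \sum_(g <- e) g)}.
  have : uniq [seq \sum_(g <- e) g | e : {mset G}%mset <- E] by rewrite map_inj_in_uniq.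
  by move=> /(uniq_card_setT fG); rewrite size_map leqNgt NE.
move=> /existsNP[e /existsNP[e' /not_implyP[eE /not_implyP[e'E]]]].
move=> /not_implyP[es /eqP nee].
have le g : (e g <= X g)%N by apply: (submsets_le _ _ eE); apply: fset_uniq.
have le' g : (e' g <= X g)%N by apply: (submsets_le _ _ e'E); apply: fset_uniq.
(* Removing the common part keeps the sums equal and makes the two multisets disjoint; as [e] and
   [e'] differ, something is left. *)
pose i := msetI e e'.
have sumD (x y : {mset G}%mset) :
    \sum_(g <- msetD x y) g = \sum_(g <- x) g + \sum_(g <- y) g.
  by rewrite (perm_big _ (perm_enum_msetD x y)) big_cat.
have ei : e = msetD (msetB e i) i by apply/msetP => g; rewrite !msetE2; lia.
have ei' : e' = msetD (msetB e' i) i by apply/msetP => g; rewrite !msetE2; lia.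
exists (msetB e i), (msetB e' i), (msetB (msetB X (msetB e i)) (msetB e' i)); split.
- rewrite -(permPl Xs); apply/allP => g _ /=.
  rewrite !count_cat !count_mem_mset !msetE2; have := le g; have := le' g; lia.
- by move=> g; rewrite !in_msetB !msetE2; lia.
- rewrite lt0n addn_eq0 !size_mset_eq0; apply: contra nee => /andP[/eqP a /eqP b].
  by rewrite ei ei' a b.
- by move: es; rewrite {1}ei {1}ei' !sumD => /addIr.
Qed.

(** Used to lift a rearrangement of a list of classes to the elements that carry them. *)
Lemma perm_map_inv (T T' : eqType) (f : T -> T') (s : seq T) (t : seq T') :
  perm_eq (map f s) t -> exists2 s', perm_eq s s' & map f s' = t.
Proof.
case: s => [|x0 s0]; first by rewrite perm_sym => /perm_nilP->; exists [::].
set s := x0 :: s0; rewrite perm_sym => /(perm_iotaP (f x0))[I pI et].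
exists [seq nth x0 s i | i <- I].
  rewrite perm_sym; apply/(perm_iotaP x0); exists I => //.
  by move: pI; rewrite size_map.
rewrite et -map_comp; apply/eq_in_map => i.
rewrite (perm_mem pI) mem_iota add0n size_map => /andP[_ il].
exact/esym/(@nth_map _ x0 _ (f x0) f i s).
Qed.

(** * Exchange arguments in a shortest factorization of [u + v] *)

Section Core.
Variables (P : choiceType) (G : zmodType) (c : {additive free_monoid P -> G}).
Local Notation F := (free_monoid P).
Implicit Types (u v w y z : F) (ws : seq F) (t : F * F) (prs I J R : seq (F * F)).

(** If [t.2] were zero, [t.1] would be a zero-sum part of [u], hence all of [u]; the remaining
    factors would then factor the atom [v], leaving two factors in total. *)
Lemma factor_right_neq0 u v prs :
  zs_atom c u -> zs_atom c v -> (2 < size prs)%N ->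
  (forall t, t \in prs -> zs_atom c (t.1 + t.2)) ->
  \sum_(t <- prs) t.1 = u -> \sum_(t <- prs) t.2 = v ->
  forall t, t \in prs -> t.2 != 0.
Proof.
move=> [u0 cu hu] av sz aprs eu ev t tprs; apply/eqP => t20.
have pr := perm_to_rem tprs.
have := aprs _ tprs; rewrite t20 addr0 => -[t10 ct _].
have [|//|r0] := hu t.1 (\sum_(s <- rem t prs) s.1) _ ct.
  by rewrite -eu (perm_big _ pr) big_cons.
have : zs_factor c [seq s.1 + s.2 | s <- rem t prs] v.
  split; first by move=> w /mapP[s /mem_rem/aprs ? ->].
  by rewrite big_map big_split /= r0 add0r -ev (perm_big _ pr) big_cons t20 /= add0r.
move=> /(zs_atom_factor av); rewrite size_map size_rem //.
by move: sz; case: (size prs) => [|[|[|k]]].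
Qed.

Lemma two_sided_factor u v ws :
  zs_atom c u -> zs_atom c v -> (2 < size ws)%N -> zs_factor c ws (u + v) ->
  exists prs, [/\ size prs = size ws,
    forall t, t \in prs -> [/\ zs_atom c (t.1 + t.2), t.1 != 0 & t.2 != 0],
    \sum_(t <- prs) t.1 = u & \sum_(t <- prs) t.2 = v].
Proof.
move=> au av sz [aws /sum_refinement[prs [ews eu ev]]].
have sp : size prs = size ws by rewrite ews size_map.
have aprs t : t \in prs -> zs_atom c (t.1 + t.2).
  by move=> tp; apply: aws; rewrite ews; apply/mapP; exists t.
exists prs; split => // t tp; split; first exact: aprs.
  (* The left halves follow from the same lemma with [u] and [v] interchanged. *)
  pose sw (s : F * F) := (s.2, s.1).
  apply: (@factor_right_neq0 v u (map sw prs) av au _ _ _ _ (sw t)).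
  - by rewrite size_map sp.
  - by move=> _ /mapP[s sp' ->]; rewrite addrC; apply: aprs.
  - by rewrite big_map.
  - by rewrite big_map.
  - exact: map_f.
by apply: (factor_right_neq0 au av _ aprs eu ev) => //; rewrite sp.
Qed.

(* [prs] lists the factors of [u + v], each split into its part in [u] and its
   part in [v]. *)
Definition short_factor u v prs :=
  [/\ zs_atom c u, zs_atom c v,
      forall t, t \in prs -> [/\ zs_atom c (t.1 + t.2), t.1 != 0 & t.2 != 0],
      \sum_(t <- prs) t.1 = u /\ \sum_(t <- prs) t.2 = v &
      forall ws, zs_factor c ws (u + v) -> (2 < size ws)%N ->
        (size prs <= size ws)%N].

Lemma sum_len1 (T : eqType) (s : seq T) (f : T -> F) :
  (forall i, i \in s -> len (f i) = 1%N) -> len (\sum_(i <- s) f i) = size s.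
Proof.
by move=> h; rewrite len_sum -sum1_size big_seq [RHS]big_seq; apply: eq_bigr.
Qed.

Lemma sum_class (T : eqType) (s : seq T) (f : T -> F) (g : G) :
  (forall i, i \in s -> c (f i) = g) -> c (\sum_(i <- s) f i) = g *+ size s.
Proof.
move=> h; rewrite raddf_sum (eq_big_seq (fun=> g) h) big_const_seq count_predT.
exact: iter_addr_0.
Qed.

Lemma pair_class t : zs_atom c (t.1 + t.2) -> c t.2 = - c t.1.
Proof.
by case=> _ + _; rewrite raddfD => /eqP; rewrite addrC addr_eq0 => /eqP.
Qed.

(** New factorizations of [u + v] arise by joining a part of one atom to a part of the other; as [y]
    is a proper part of [u], the number of factors stays under control. *)
Lemma cross_factor u z y y' :
  zs_atom c u -> u = y + y' -> y' != 0 -> c (y + z) = 0 ->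
  exists2 ws, zs_factor c ws (y + z) & (size ws <= len z)%N.
Proof.
move=> au eu /eqP y'0 /zs_factor_ex[ws fws]; exists ws => //.
exact: (proper_part_factor_size au eu y'0 fws).
Qed.

Lemma zs_factor_size_gt0 ws x : zs_factor c ws x -> x != 0 -> (0 < size ws)%N.
Proof. by case: ws => // /zs_factor_nil->; rewrite eqxx. Qed.

(** In a [short_factor] both halves of each pair are nonzero, so these are exactly the factors of
    length 2. *)
Definition single t := (len t.1 == 1%N) && (len t.2 == 1%N).

(* With [U = A1 + A2 + U'] and [V = B1 + B2 + V'], where the pairs in
   [A1 + B1] and in [A2 + B2] all have class [g], [n - m - 1] resp.
   [2 (m + 1) - n] of them, the element [U + V] also splits into the zero-sum
   elements [U' + B1], [V' + A1] and [A2 + B2]. *)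
Lemma heavy_class n u v prs (g : G) :
  (1 < n)%N -> (forall h : G, h *+ n = 0) -> short_factor u v prs ->
  (n %/ 2 < count (fun t => single t && (c t.1 == g)) prs)%N ->
  (size prs <= n)%N.
Proof.
move=> n1 nG [au av aprs [eu ev] minl]; set a := (fun t => _) => hc.
(* [i + k = n] makes the classes of the mixed elements vanish, and [i + j = k] is the number of
   pairs used; [j] is 1 or 2. *)
pose k := (n %/ 2).+1; pose i := (n - k)%N; pose j := (k + k - n)%N.
have [ki ki'] : (i + k = n /\ i + j = k)%N.
  by rewrite /i /j /k; have := divn_eq n 2; have := ltn_pmod n (isT : 0 < 2)%N; lia.
have j0 : (0 < j)%N.
  by rewrite /j /k; have := divn_eq n 2; have := ltn_pmod n (isT : 0 < 2)%N; lia.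
pose S := seq.filter a prs; pose X := take i S; pose Y := take j (drop i S).
pose Z := drop j (drop i S) ++ seq.filter (predC a) prs.
have sS : (k <= size S)%N by rewrite size_filter.
have pr : perm_eq prs (X ++ Y ++ Z).
  by rewrite /X /Y /Z !catA -[X in X ++ _]catA !cat_take_drop perm_sym
    perm_filterC.
have sX : size X = i by rewrite size_takel //; lia.
have sY : size Y = j by rewrite size_takel // size_drop; lia.
have XY t : t \in X ++ Y ->
    [/\ t \in prs, len t.1 = 1%N, len t.2 = 1%N, c t.1 = g & c t.2 = - g].
  move=> tXY; have : t \in S.
    rewrite -(cat_take_drop i S) -(cat_take_drop j (drop i S)) catA mem_cat.
    by rewrite tXY.
  rewrite mem_filter => /andP[/andP[/andP[/eqP t1 /eqP t2] /eqP ct] tp].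
  by split=> //; rewrite pair_class ?ct //; have [] := aprs _ tp.
have Xh t : t \in X -> [/\ t \in prs, len t.1 = 1%N, len t.2 = 1%N, c t.1 = g
    & c t.2 = - g] by move=> h; apply: XY; rewrite mem_cat h.
have Yh t : t \in Y -> [/\ t \in prs, len t.1 = 1%N, len t.2 = 1%N, c t.1 = g
    & c t.2 = - g] by move=> h; apply: XY; rewrite mem_cat h orbT.
pose A1 : F := \sum_(t <- X) t.1; pose B1 : F := \sum_(t <- X) t.2.
pose A2 : F := \sum_(t <- Y) t.1; pose B2 : F := \sum_(t <- Y) t.2.
pose U' : F := \sum_(t <- Z) t.1; pose V' : F := \sum_(t <- Z) t.2.
have lA1 : len A1 = i by rewrite sum_len1 // => t /Xh[].
have lB1 : len B1 = i by rewrite sum_len1 // => t /Xh[].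
have lA2 : len A2 = j by rewrite sum_len1 // => t /Yh[].
have lB2 : len B2 = j by rewrite sum_len1 // => t /Yh[].
have cA1 : c A1 = g *+ i by rewrite -sX; apply: sum_class => t /Xh[].
have cB1 : c B1 = (- g) *+ i by rewrite -sX; apply: sum_class => t /Xh[].
have cA2 : c A2 = g *+ j by rewrite -sY; apply: sum_class => t /Yh[].
have cB2 : c B2 = (- g) *+ j by rewrite -sY; apply: sum_class => t /Yh[].
have eU : u = U' + (A1 + A2).
  by rewrite -eu (perm_big _ pr) 2!big_cat /= addrA addrC.
have eV : v = V' + (B1 + B2).
  by rewrite -ev (perm_big _ pr) 2!big_cat /= addrA addrC.
have cU : c U' = - (g *+ k).
  have [_ + _] := au; rewrite eU !raddfD /= cA1 cA2 -mulrnDr ki'.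
  by move=> /eqP; rewrite addr_eq0 => /eqP.
have cV : c V' = g *+ k.
  have [_ + _] := av; rewrite eV !raddfD /= cB1 cB2 -mulrnDr ki'.
  by move=> /eqP; rewrite addr_eq0 => /eqP->; rewrite mulNrn opprK.
have [ws1 f1 s1] : exists2 ws, zs_factor c ws (U' + B1) & (size ws <= len B1)%N.
  apply: (cross_factor au eU); first by rewrite -len_gt0 lenD lA2; lia.
  by rewrite raddfD /= cU cB1 mulNrn -opprD -mulrnDr addnC ki nG oppr0.
have [ws2 f2 s2] : exists2 ws, zs_factor c ws (V' + A1) & (size ws <= len A1)%N.
  apply: (cross_factor av eV); first by rewrite -len_gt0 lenD lB2; lia.
  by rewrite raddfD /= cV cA1 -mulrnDr addnC ki nG.
have f3 : zs_factor c [seq t.1 + t.2 | t <- Y] (A2 + B2).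
  split; last by rewrite big_map big_split.
  by move=> w /mapP[t /Yh[/aprs[? _ _] _ _ _ _] ->].
have f : zs_factor c (ws1 ++ ws2 ++ [seq t.1 + t.2 | t <- Y]) (u + v).
  have := zs_factor_cat f1 (zs_factor_cat f2 f3); congr (zs_factor c _ _).
  rewrite eU eV; apply/msetP => p; rewrite !msetE2; lia.
have szlen : (size prs <= len u)%N.
  by rewrite -eu; apply: size_le_sum_len => t /aprs[].
(* [i = 0] occurs only for [n = 2]: then [U'] is a sum of no atoms, hence zero, and [u] has length
   [j = n]. *)
case: (posnP i) => [i0|i0].
  have := s1; rewrite lB1 i0 leqn0 => /nilP w0; rewrite w0 in f1.
  have /(congr1 (@len P)) := zs_factor_nil f1; rewrite len0 lenD => U0.
  by apply: leq_trans szlen _; rewrite eU !lenD; lia.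
have g1 : (0 < size ws1)%N.
  by apply: (zs_factor_size_gt0 f1); rewrite -len_gt0 lenD; lia.
have g2 : (0 < size ws2)%N.
  by apply: (zs_factor_size_gt0 f2); rewrite -len_gt0 lenD; lia.
(* The new factorization has at least [1 + 1 + j] factors, so more than 2, and at most
   [i + i + j = n]. *)
have := minl _ f; rewrite !size_cat size_map sY; lia.
Qed.

Lemma sum_eq_size (T : eqType) (s : seq T) (f : T -> nat) :
  (forall i, i \in s -> (0 < f i)%N) -> (\sum_(i <- s) f i <= size s)%N ->
  forall i, i \in s -> f i = 1%N.
Proof.
move=> h; rewrite -sum1_size => le i si.
have := h i si; move: le; rewrite !(perm_big _ (perm_to_rem si)) /= !big_cons.
have : (\sum_(j <- rem i s) 1 <= \sum_(j <- rem i s) f j)%N.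
  by rewrite big_seq [leqRHS]big_seq; apply: leq_sum => j /mem_rem/h.
lia.
Qed.

(* Exchanging the right halves of [I] and [J] turns the factors in [I ++ J]
   into at most [2 * minn (size I) (size J)] others, with equality only if
   these are again pairs; but then [I] and [J] share a class. *)
Lemma no_exchange u v prs I J R :
  short_factor u v prs -> perm_eq prs (I ++ J ++ R) ->
  (0 < size I + size J)%N -> (0 < size R)%N ->
  (forall t, t \in I ++ J -> single t) ->
  \sum_(t <- I) c t.1 = \sum_(t <- J) c t.1 ->
  ~ (forall s t, s \in I -> t \in J -> c s.1 != c t.1).
Proof.
move=> [au av aprs [eu ev] minl] pr IJ0 R0 sIJ cIJ disj.
have Ih t : t \in I -> [/\ t \in prs, len t.1 = 1%N, len t.2 = 1%N
    & c t.2 = - c t.1].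
  move=> tI; have tp : t \in prs by rewrite (perm_mem pr) mem_cat tI.
  have /andP[/eqP ? /eqP ?] : single t by apply: sIJ; rewrite mem_cat tI.
  by split=> //; apply: pair_class; have [] := aprs _ tp.
have Jh t : t \in J -> [/\ t \in prs, len t.1 = 1%N, len t.2 = 1%N
    & c t.2 = - c t.1].
  move=> tJ; have tp : t \in prs by rewrite (perm_mem pr) !mem_cat tJ orbT.
  have /andP[/eqP ? /eqP ?] : single t by apply: sIJ; rewrite mem_cat tJ orbT.
  by split=> //; apply: pair_class; have [] := aprs _ tp.
have Rh t : t \in R -> t \in prs.
  by move=> tR; rewrite (perm_mem pr) !mem_cat tR !orbT.
pose PI : F := \sum_(t <- I) t.1; pose QI : F := \sum_(t <- I) t.2.
pose PJ : F := \sum_(t <- J) t.1; pose QJ : F := \sum_(t <- J) t.2.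
pose PR : F := \sum_(t <- R) t.1; pose QR : F := \sum_(t <- R) t.2.
have lPI : len PI = size I by rewrite sum_len1 // => t /Ih[].
have lQI : len QI = size I by rewrite sum_len1 // => t /Ih[].
have lPJ : len PJ = size J by rewrite sum_len1 // => t /Jh[].
have lQJ : len QJ = size J by rewrite sum_len1 // => t /Jh[].
have lPR : (0 < len PR)%N.
  by apply: leq_trans R0 _; apply: size_le_sum_len => t /Rh/aprs[].
have lQR : (0 < len QR)%N.
  by apply: leq_trans R0 _; apply: size_le_sum_len => t /Rh/aprs[].
have cPI : c PI = c PJ by rewrite !raddf_sum.
have cQI : c QI = - c PI.
  rewrite [c QI]raddf_sum [c PI]raddf_sum -sumrN.
  by apply: eq_big_seq => t /Ih[].
have cQJ : c QJ = - c PJ.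
  rewrite [c QJ]raddf_sum [c PJ]raddf_sum -sumrN.
  by apply: eq_big_seq => t /Jh[].
have eU : u = PI + (PJ + PR) by rewrite -eu (perm_big _ pr) !big_cat.
have eU' : u = PJ + (PI + PR) by rewrite addrCA.
have eV : v = QI + (QJ + QR) by rewrite -ev (perm_big _ pr) !big_cat.
have eV' : v = QJ + (QI + QR) by rewrite addrCA.
have zs_part y y' : u = y + y' -> (0 < len y')%N -> c y = 0 -> len y = 0%N.
  have [_ _ hu] := au => e l' /(hu _ _ e)[->|y'0]; first by rewrite len0.
  by rewrite y'0 len0 in l'.
(* If [I] were empty, the left halves from [J] would form a zero-sum part of [u], proper because [R]
   is nonempty; so [J] would be empty too. *)
have I0 : (0 < size I)%N.
  rewrite lt0n; apply/eqP => sI0; move: lPI; rewrite sI0 => /eqP.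
  rewrite len_eq0 => /eqP PI0; move: cPI; rewrite PI0 raddf0 => /esym cPJ.
  have := zs_part _ _ eU' _ cPJ; rewrite lenD lPJ; lia.
have J0 : (0 < size J)%N.
  rewrite lt0n; apply/eqP => sJ0; move: lPJ; rewrite sJ0 => /eqP.
  rewrite len_eq0 => /eqP PJ0; move: cPI; rewrite PJ0 raddf0 => cPI.
  have := zs_part _ _ eU _ cPI; rewrite lenD lPI; lia.
have [ws1 f1 s1] : exists2 ws, zs_factor c ws (PI + QJ) & (size ws <= len QJ)%N.
  apply: (cross_factor au eU); first by rewrite -len_gt0 lenD; lia.
  by rewrite raddfD /= cQJ cPI subrr.
(* The same factors counted from the other side: [QJ] is a proper part of [v]. *)
have s1' : (size ws1 <= len PI)%N.
  apply: (proper_part_factor_size av eV'); last by rewrite addrC.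
  by apply/eqP; rewrite -len_gt0 lenD; lia.
have [ws2 f2 s2] : exists2 ws, zs_factor c ws (PJ + QI) & (size ws <= len QI)%N.
  apply: (cross_factor au eU'); first by rewrite -len_gt0 lenD; lia.
  by rewrite raddfD /= cQI cPI subrr.
have s2' : (size ws2 <= len PJ)%N.
  apply: (proper_part_factor_size av eV); last by rewrite addrC.
  by apply/eqP; rewrite -len_gt0 lenD; lia.
have f3 : zs_factor c [seq t.1 + t.2 | t <- R] (PR + QR).
  split; last by rewrite big_map big_split.
  by move=> w /mapP[t /Rh/aprs[? _ _] ->].
have f : zs_factor c (ws1 ++ ws2 ++ [seq t.1 + t.2 | t <- R]) (u + v).
  have := zs_factor_cat f1 (zs_factor_cat f2 f3); congr (zs_factor c _ _).
  rewrite eU eV; apply/msetP => p; rewrite !msetE2; lia.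
have g1 : (0 < size ws1)%N.
  by apply: (zs_factor_size_gt0 f1); rewrite -len_gt0 lenD; lia.
have g2 : (0 < size ws2)%N.
  by apply: (zs_factor_size_gt0 f2); rewrite -len_gt0 lenD; lia.
have hmin : (size I + (size J + size R) <= size ws1 + (size ws2 + size R))%N.
  by have := minl _ f; rewrite (perm_size pr) !size_cat size_map; apply; lia.
rewrite lQJ in s1; rewrite lPI in s1'; rewrite lQI in s2; rewrite lPJ in s2'.
(* Neither [ws1] nor [ws2] exceeds [size I] or [size J], so the lower bound [hmin] forces
   equality. *)
have [e1 e2] : size ws1 = size I /\ size ws1 = size J by lia.
have [aws1 /sum_refinement[prs1 [ews1 eP eQ]]] := f1.
have ap1 t : t \in prs1 -> zs_atom c (t.1 + t.2).
  by move=> tp; apply: aws1; rewrite ews1; apply/mapP; exists t.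
have sp1 : size prs1 = size ws1 by rewrite ews1 size_map.
have n2 : forall t, t \in prs1 -> t.2 != 0.
  apply: (proper_part_factor au eU _ ap1 eP).
  by apply/eqP; rewrite -len_gt0 lenD; lia.
have n1 t : t \in prs1 -> t.1 != 0.
  pose sw (s : F * F) := (s.2, s.1) => tp.
  apply: (@proper_part_factor _ _ _ v QJ (QI + QR) (map sw prs1) av eV' _ _ _ (sw t)).
  - by apply/eqP; rewrite -len_gt0 lenD; lia.
  - by move=> _ /mapP[s sp' ->]; rewrite addrC; apply: ap1.
  - by rewrite big_map.
  - exact: map_f.
have [t tp] : exists t, t \in prs1.
  by case: (prs1) sp1 => [|t ?] /=; [lia|exists t; rewrite mem_head].
have l1 : len t.1 = 1%N.
  apply: (@sum_eq_size _ prs1 (fun t => len t.1)) tp => [s /n1|].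
    by rewrite len_gt0.
  by rewrite -len_sum eP lPI sp1 e1.
have l2 : len t.2 = 1%N.
  apply: (@sum_eq_size _ prs1 (fun t => len t.2)) tp => [s /n2|].
    by rewrite len_gt0.
  by rewrite -len_sum eQ lQJ sp1 e2.
(* A factor from [ws1] thus joins the left half of some [i] in [I] to the right half of some [j] in
   [J]; being zero-sum, it gives [i] and [j] the same class. *)
have /mapP[i iI ti] : t.1 \in [seq s.1 | s <- I].
  apply: len1_sum => //; first by move=> w /mapP[s /Ih[_ ? _ _] ->].
  exists (\sum_(s <- rem t prs1) s.1).
  by rewrite big_map -/PI -eP (perm_big _ (perm_to_rem tp)) big_cons.
have /mapP[j jJ tj] : t.2 \in [seq s.2 | s <- J].
  apply: len1_sum => //; first by move=> w /mapP[s /Jh[_ _ ? _] ->].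
  exists (\sum_(s <- rem t prs1) s.2).
  by rewrite big_map -/QJ -eQ (perm_big _ (perm_to_rem tp)) big_cons.
have := disj i j iI jJ; have [_ _ _ cj] := Jh j jJ.
by have := pair_class (ap1 _ tp); rewrite ti tj cj => /oppr_inj->; rewrite eqxx.
Qed.

(** [K] is left free here; its optimal value is chosen only in the final bound. *)
Lemma short_factor_size n K u v prs :
  finite_set [set: G] -> (1 < n)%N -> (forall h : G, h *+ n = 0) ->
  short_factor u v prs -> (n < size prs)%N ->
  exists2 j : nat, (3 * size prs <= len u + len v + j)%N &
    (j * (n %/ 2).+1 ^ K <=
       K * (n %/ 2) * (n %/ 2).+1 ^ K + #|` fset_set [set: G]|)%N.
Proof.
move=> fG n1 nG sf nsz; set m := (n %/ 2)%N.
have [au av aprs [eu ev] minl] := sf.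
(* Every factor has length at least 2, and at least 3 unless it is [single]. *)
exists (count single prs).
  rewrite -eu -ev !len_sum -big_split -sum1_size big_distrr -sum1_count.
  rewrite [X in (_ <= _ + X)%N]big_mkcond -big_split /=.
  rewrite big_seq [leqRHS]big_seq; apply: leq_sum => t /aprs[_].
  rewrite -!len_gt0 /single; case: ifP => [/andP[/eqP-> /eqP->] //|].
  by move=> /negbT; rewrite negb_and => /orP[] /eqP; lia.
(* One pair [h] of length 2 is set aside so that the rest [R] of the exchange is never empty; it
   accounts for the successor in [disjoint_equal_subsums]. *)
rewrite -size_filter; case eS: (seq.filter single prs) => [|h T]; first by rewrite mul0n.
rewrite leqNgt; apply/negP => hlt.
have cT g : (count_mem g [seq c t.1 | t <- T] <= m)%N.
  rewrite leqNgt; apply/negP => hc; suff : (size prs <= n)%N by lia.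
  apply: (heavy_class n1 nG sf (g := g)); apply: leq_trans hc _.
  rewrite count_map.
  have -> : count (fun t => single t && (c t.1 == g)) prs =
      count (fun t => c t.1 == g) (seq.filter single prs).
    by rewrite count_filter; apply: eq_count => t /=; rewrite andbC.
  by rewrite eS /= leq_addl.
have [|d [d' [r [pT disj dd0 sd]]]] := disjoint_equal_subsums (K := K) fG cT.
  by rewrite size_map addnC.
have [T' pT' eT'] := perm_map_inv pT.
pose I := take (size d) T'; pose J := take (size d') (drop (size d) T').
pose R := drop (size d') (drop (size d) T').
have eI : [seq c t.1 | t <- I] = d.
  by rewrite map_take eT' take_size_cat.
have eJ : [seq c t.1 | t <- J] = d'.
  by rewrite map_take map_drop eT' drop_size_cat // take_size_cat.
have eIJR : T' = I ++ J ++ R by rewrite !cat_take_drop.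
have pp : perm_eq prs (I ++ J ++ (R ++ h :: seq.filter (predC single) prs)).
  rewrite -(perm_filterC single prs) eS.
  have -> : I ++ J ++ R ++ h :: seq.filter (predC single) prs =
      T' ++ [:: h] ++ seq.filter (predC single) prs by rewrite eIJR -!catA.
  by rewrite perm_sym perm_catCA /= perm_cons perm_cat2r perm_sym.
apply: (no_exchange sf pp).
- by rewrite -(size_map (fun t => c t.1) I) eI -(size_map (fun t => c t.1) J) eJ.
- by rewrite size_cat /=; lia.
- move=> t tIJ; suff : t \in seq.filter single prs by rewrite mem_filter => /andP[].
  rewrite eS inE (perm_mem pT') eIJR catA mem_cat tIJ /= orbT //.
- by rewrite -(big_map (fun t => c t.1) xpredT id) eI sd -eJ big_map.
- move=> s t sI tJ; apply/eqP => e.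
  have : c s.1 \in d by rewrite -eI; apply/mapP; exists s.
  by move=> /disj/negP; apply; rewrite e -eJ; apply/mapP; exists t.
Qed.

End Core.

(** * Transfer from [H] to zero-sum elements of the free monoid *)

Section Transfer.
Local Open Scope quotient_scope.
Variables (H : cmonoidType) (P : choiceType) (phi : {additive H -> free_monoid P}).

Fact class_of_nmod_morphism : nmod_morphism (class_of phi).
Proof.
split=> [|x y]; first by rewrite /class_of qdiff0 raddf0.
have N : qdiff 0 y = - qdiff y 0.
  by have := qdiffB 0 0 y (0 : free_monoid P); rewrite qdiff0 sub0r !add0r.
rewrite /class_of -raddfD; congr (\pi _).
by rewrite -[qdiff y 0]opprK -N qdiffB addr0.
Qed.

HB.instance Definition _ := GRing.isNmodMorphism.Build (free_monoid P)
  (class_group phi) (class_of phi) class_of_nmod_morphism.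

Local Notation cls := (class_of phi).

Hypothesis divphi : divisor_hom phi.

(** If [x] is the difference of [phi a] and [phi b], then [phi b] divides [phi a], so [b] divides
    [a], and the cofactor maps to [x]. *)
Lemma class_of_eq0 x : cls x = 0 <-> exists h, x = phi h.
Proof.
rewrite /class_of; split=> [/eqP|[h ->]].
  rewrite piE Quotient.equivE subr0 => /asboolP[a [b]].
  move=> /eqmodP; rewrite /= /diff_eq /= => /eqP e.
  have [|d ed] := divphi (a := b) (b := a).
    by exists x; rewrite -[phi a]addr0 -e addrC.
  by exists d; move: e; rewrite addr0 ed raddfD addrC => /fm_addI.
apply/eqP; rewrite piE Quotient.equivE subr0; apply/asboolP; exists h, 0.
by rewrite raddf0.
Qed.

Lemma phi_unit h : is_unit h <-> phi h = 0.
Proof.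
split=> [[b /(congr1 phi)]|e].
  rewrite raddfD raddf0 => /(congr1 (@len P)); rewrite lenD len0 => e.
  by apply/eqP; rewrite -len_eq0; lia.
have [|b eb] := divphi (a := h) (b := 0); last by exists b.
by exists 0; rewrite e raddf0 addr0.
Qed.

(** A zero-sum part of [phi h] is the image of some element, which divides [h] because [phi] is a
    divisor homomorphism. *)
Lemma atom_zs_atom h : atom h <-> zs_atom cls (phi h).
Proof.
have c0 x : cls (phi x) = 0 by apply/class_of_eq0; exists x.
split=> [[nu hu]|[h0 _ hh]].
  split; [by move=> /phi_unit | exact: c0 | move=> y z e cy].
  have cz : cls z = 0.
    by have := c0 h; rewrite e raddfD cy add0r.
  move/class_of_eq0: cy => [a ey]; move/class_of_eq0: cz => [b ez].
  have [|d ed] := divphi (a := a) (b := h); first by exists z; rewrite e ey.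
  have [/phi_unit|/phi_unit pd] := hu _ _ ed; first by rewrite ey; left.
  by right; move: e; rewrite ed raddfD pd ey => /fm_addI.
split=> [/phi_unit //|a b e].
have [|||] := hh (phi a) (phi b).
- by rewrite e raddfD.
- exact: c0.
- by move=> /phi_unit; left.
- by move=> /phi_unit; right.
Qed.

(** Factors of [phi h] have class 0, so they lift to atoms one by one; the sum of the lifts has the
    same image as [h] and differs from it by a unit. *)
Lemma lengths_zs_factor h k :
  lengths h k <-> exists2 ws, zs_factor cls ws (phi h) & size ws = k.
Proof.
split=> [[s as_ [/asboolP[w uw ew] sk]]|[ws [aws ews] sk]].
  exists (map phi s); last by rewrite size_map.
  split=> [w' /mapP[a /as_/atom_zs_atom ? ->] //|].
  rewrite big_map -raddf_sum ew raddfD.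
  by move/phi_unit: uw => ->; rewrite addr0.
have [s es] : exists s, map phi s = ws.
  have cw w : w \in ws -> exists h, w = phi h.
    by move=> /aws[_ /class_of_eq0].
  elim: (ws) cw => [|w t IH] cw; first by exists [::].
  have [|s <-] := IH; first by move=> w' w't; apply: cw; rewrite inE w't orbT.
  have [|a ->] := cw w; first by rewrite mem_head.
  by exists (a :: s).
exists s; first by move=> a sa; apply/atom_zs_atom/aws; rewrite -es map_f.
split; last by rewrite -sk -es size_map.
apply/asboolP; have e : phi (\sum_(a <- s) a) = phi h.
  by rewrite raddf_sum -ews -es big_map.
have [|d ed] := divphi (a := h) (b := \sum_(a <- s) a).
  by exists 0; rewrite e addr0.
exists d => //; apply/phi_unit.
by move: e; rewrite ed raddfD -[RHS]addr0 => /fm_addI.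
Qed.

End Transfer.

(** * The Davenport constant as a bound on the length of zero-sum atoms *)

Section Davenport.
Variables (H : cmonoidType) (P : choiceType) (phi : {additive H -> free_monoid P}).
Local Notation cls := (class_of phi).

(** [set_max] falls back to 0 on unbounded sets; the bound [b] guarantees that the maximum is
    attained. *)
Lemma set_max_ge (A : set nat) a b :
  A a -> (forall j, A j -> (j <= b)%N) -> (a <= set_max A)%N.
Proof.
move=> Aa Ab; rewrite /set_max; case: xgetP => [k _ [_ /(_ _ Aa)] //|nex].
have ex : exists k, `[< A k >] by exists a; apply/asboolP.
have bd k : `[< A k >] -> (k <= b)%N by move=> /asboolP/Ab.
case: (ex_maxnP ex bd) => k /asboolP Ak kmax.
by exfalso; apply: (nex k); split=> // j Aj; apply: kmax; apply/asboolP.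
Qed.

Lemma seq_mset_cat (K : choiceType) (s t : seq K) :
  seq_mset (s ++ t) = msetD (seq_mset s) (seq_mset t).
Proof. by apply/msetP => x; rewrite msetE2 !mset_seqE count_cat. Qed.

(** The sums of the prefixes shorter than [S] are distinct, since two equal ones would enclose a
    nonempty proper zero-sum segment. This makes the maximum in [davenport] exist. *)
Lemma minimal_zero_sum_size (G : zmodType) (G0 : set G) (S : {mset G}%mset) :
  finite_set [set: G] -> minimal_zero_sum G0 S ->
  (size S <= #|` fset_set [set: G]|)%N.
Proof.
move=> fG [_ _ _ Smin].
rewrite -(size_iota 0 (size S)) -(size_map (fun i => \sum_(g <- take i S) g)).
apply: uniq_card_setT => //; rewrite map_inj_in_uniq ?iota_uniq // => i j.
rewrite !mem_iota !add0n /= => iS jS.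
wlog ij : i j iS jS / (i <= j)%N => [hw|].
  by case: (leqP i j) => [/hw|/ltnW /hw h /esym/h]; [apply|move=> ->].
move=> e; apply/eqP; rewrite eqn_leq ij leqNgt; apply/negP => {}ij.
pose T := drop i (take j S).
have pS : perm_eq S (T ++ take i S ++ drop j S).
  rewrite -{1}(cat_take_drop j S) -{1}(cat_take_drop i (take j S)).
  by rewrite take_takel 1?ltnW // -catA perm_catCA.
have eS : S = msetD (seq_mset T) (seq_mset (take i S ++ drop j S)).
  by rewrite -seq_mset_cat -[LHS]seq_mset_id; apply/eq_seq_msetP.
have sT : size T = (j - i)%N by rewrite size_drop size_takel // ltnW.
have sR : (0 < size (take i S ++ drop j S))%N.
  by rewrite size_cat size_drop addn_gt0 subn_gt0 jS orbT.
have szm (s : seq G) : size (seq_mset s) = size s.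
  exact: perm_size (perm_eq_seq_mset s).
apply: (Smin (seq_mset T)).
- by move=> /eqP; rewrite -size_mset_eq0 szm sT; lia.
- rewrite mproperEneq; apply/andP; split.
    apply/eqP => eT.
    have e1 : size S = (size T + size (take i S ++ drop j S))%N.
      by rewrite -size_cat; apply: perm_size.
    have e2 : size T = size S by rewrite -szm eT.
    by move: sR; rewrite -(ltn_add2l (size T)) -e1 addn0 e2 ltnn.
  by rewrite [X in msubset _ X]eS; apply/msubsetP => g; rewrite msetE2 leq_addr.
- rewrite (perm_big _ (perm_eq_seq_mset T)) /=.
  move: e; rewrite -(cat_take_drop i (take j S)) take_takel 1?ltnW //.
  by rewrite big_cat /= -[LHS]addr0 => /addrI.
Qed.

Lemma sum_free_gen (s : seq P) : \sum_(p <- s) free_gen p = seq_mset s.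
Proof.
elim: s => [|p s IH]; last by rewrite big_cons IH mset_cons.
by rewrite big_nil; apply/msetP => p; rewrite mset_seqE mset0E.
Qed.

Lemma class_of_seq (s : seq P) :
  cls (seq_mset s) = \sum_(p <- s) cls (free_gen p).
Proof. by rewrite -sum_free_gen raddf_sum. Qed.

(** The classes of the primes in [x] form a minimal zero-sum sequence: a proper zero-sum part of it
    would lift to one of [x]. *)
Lemma zs_atom_davenport x :
  finite_set [set: class_group phi] -> zs_atom cls x ->
  (len x <= davenport (prime_classes phi))%N.
Proof.
move=> fG [x0 cx hx]; pose f p := cls (free_gen p); pose s := enum_mset x.
have xs : x = seq_mset s by rewrite /s seq_mset_id.
pose S := seq_mset (map f s).
have szm (K : choiceType) (t : seq K) : size (seq_mset t) = size t.
  exact: perm_size (perm_eq_seq_mset t).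
apply: (set_max_ge (b := #|` fset_set [set: class_group phi]|)); last first.
  by move=> _ [T mT <-]; apply: minimal_zero_sum_size mT.
exists S; last by rewrite szm size_map.
split.
- by move/eqP; rewrite -size_mset_eq0 szm size_map; move: x0 => /eqP; rewrite -len_eq0 => /negP.
- move=> g; rewrite (perm_mem (perm_eq_seq_mset _)) => /mapP[p _ ->].
  by exists p.
- by rewrite (perm_big _ (perm_eq_seq_mset _)) /= big_map -class_of_seq -xs.
move=> T /eqP T0; rewrite mproperEneq => /andP[TS TleS] sT.
have : perm_eq (map f s) (T ++ msetB S T).
  rewrite -(permPl (perm_eq_seq_mset (map f s))) -/S.
  by have := perm_enum_msetD T (msetB S T); rewrite msetBDKC.
move=> /perm_map_inv[s' ps' es'].
pose s1 := take (size T) s'; pose s2 := drop (size T) s'.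
have e1 : map f s1 = T by rewrite map_take es' take_size_cat.
have e2 : map f s2 = msetB S T by rewrite map_drop es' drop_size_cat.
have exx : x = (seq_mset s1 : free_monoid P) + seq_mset s2.
  rewrite xs; apply: etrans (seq_mset_cat s1 s2).
  by rewrite cat_take_drop; apply/eq_seq_msetP.
have [|/(congr1 (@len P))|/(congr1 (@len P))] := hx _ _ exx.
- by apply: etrans (class_of_seq s1) _; rewrite -[RHS]sT -e1 big_map.
- rewrite len0 /len szm -(size_map f) e1 => /eqP.
  by rewrite size_mset_eq0 (negPf T0).
- rewrite len0 /len szm -(size_map f) e2 => /eqP.
  rewrite size_mset_eq0 msetB_eq0 => ST; move: TS.
  by rewrite eqEmsubset TleS ST.
Qed.

End Davenport.

(** * Exponent, rank and order from invariant factors *)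

Section InvariantFactors.
Variable G : zmodType.

(** Along the divisibility chain every factor divides the last one, so [n] kills each coordinate. *)
Lemma has_exponent_torsion n :
  has_exponent G n -> forall h : G, h *+ n = 0.
Proof.
move=> [ns [ns1 sns [f [f' fK _]]] <-] h; apply: (can_inj fK).
apply: functional_extensionality_dep => i; rewrite raddfMn raddf0.
have q1 : (1 < nth 0 ns i)%N by move/all_nthP: ns1; apply.
have /dvdnP[k ->] : (nth 0 ns i %| last 1 ns)%N.
  have sz : (0 < size ns)%N by apply: leq_ltn_trans (ltn_ord i).
  have -> : last 1%N ns = nth 0%N ns (size ns).-1.
    by rewrite nth_last; case: (ns) sz.
  apply: (sorted_leq_nth dvdn_trans dvdnn) => //; rewrite ?inE ?prednK //.
  by rewrite -ltnS prednK.
have z : f i h *+ nth 0%N ns i = 0 by rewrite -mulr_natr pchar_Zp // mulr0.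
by rewrite mulnC mulrnA z mul0rn.
Qed.

Lemma has_exponent_gt1 n :
  finite_set [set: G] -> (1 < #|` fset_set [set: G]|)%N -> has_exponent G n ->
  (1 < n)%N.
Proof.
move=> fG c1 [[|q ns] [ns1 _ [f [f' fK _]]] <-] /=; last first.
  by move/allP: ns1; apply; apply: mem_last.
suff : (#|` fset_set [set: G]| <= 1)%N by lia.
(* With no invariant factors, where [last] defaults to 1, the direct sum is a point. *)
have all0 (x : G) : x = 0.
  by apply: (can_inj fK); apply: functional_extensionality_dep => -[].
have := fset_uniq (fset_set [set: G]).
case: (enum_fset _) => [|x [|y s]] //=.
by rewrite inE (all0 x) (all0 y) eqxx.
Qed.

(** The list giving the rank may differ from the one giving the exponent, so each factor is compared
    with [n] by torsion: [n] kills the element with all coordinates 1. Coordinates then embed [G]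
    into the functions from [r] points to [n] points. *)
Lemma has_rank_card n r :
  finite_set [set: G] -> (0 < n)%N -> (forall h : G, h *+ n = 0) ->
  has_rank G r -> (#|` fset_set [set: G]| <= n ^ r)%N.
Proof.
case: n => // n fG _ nG [ns [ns1 _ [f [f' fK f'K]]] <-].
have q1 (i : 'I_(size ns)) : (1 < nth 0 ns i)%N by move/all_nthP: ns1; apply.
have qn (i : 'I_(size ns)) : (nth 0 ns i <= n.+1)%N.
  apply: dvdn_leq => //; pose x := f' (fun j => 1).
  have /(congr1 (fun F => F i)) /= x1 : (fun j => f j x) = (fun j => 1) by apply: f'K.
  have := congr1 (f i) (nG x); rewrite raddfMn raddf0 x1 => /(congr1 val) /=.
  by rewrite val_Zp_nat // => e; rewrite /dvdn e.
pose e (g : G) : {ffun 'I_(size ns) -> 'I_n.+1} := [ffun i => inord (f i g)].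
have ei : injective e.
  move=> g h E; apply: (can_inj fK); apply: functional_extensionality_dep => i.
  have lt x : (f i x < n.+1)%N.
    apply: leq_trans (ltn_ord _) _; rewrite /= Zp_cast //.
  apply: val_inj; have /ffunP/(_ i) := E; rewrite !ffunE => /(congr1 val) /=.
  by rewrite !inordK.
have -> : (n.+1 ^ size ns = #|{ffun 'I_(size ns) -> 'I_n.+1}|)%N.
  by rewrite card_ffun !card_ord.
rewrite -(size_map e).
have /card_uniqP <- : uniq (map e (fset_set [set: G])).
  by rewrite map_inj_uniq ?fset_uniq.
exact: max_card.
Qed.

End InvariantFactors.

(** * The bound on the number of factors of length 2, as a function of [K] *)

Section Bounds.
Variable R : realType.

Definition length_bound (m N K : nat) : R :=
  (K * m)%:R + N%:R * (m%:R + 1) ^- K.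

Lemma length_bound_ge (m N K j : nat) :
  (j * m.+1 ^ K <= K * m * m.+1 ^ K + N)%N -> j%:R <= length_bound m N K.
Proof.
move=> h; have q0 : (0 : R) < (m%:R + 1) ^+ K by rewrite exprn_gt0 // natr1.
rewrite /length_bound -(ler_pM2r q0) mulrDl mulfVK ?gt_eqF //.
by rewrite natr1 -natrX -!natrM -natrD ler_nat.
Qed.

(** The sign of the increment is decided by comparing [N] with the power [K.+1] of [m + 1]. *)
Lemma length_boundS (m N K : nat) :
  length_bound m N K.+1 - length_bound m N K =
  m%:R * (1 - N%:R * (m%:R + 1) ^- K.+1).
Proof.
have q0 : (m%:R + 1 : R) != 0 by rewrite natr1 pnatr_eq0.
have qK : ((m%:R + 1) ^+ K : R) != 0 by rewrite expf_neq0.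
rewrite /length_bound !natrM exprS -natr1.
by field; rewrite q0 qK.
Qed.

(** The bound does not increase in [K] up to the truncated logarithm and does not decrease after
    it. *)
Lemma length_bound_min (m N r : nat) :
  (0 < m)%N -> (0 < N)%N ->
  length_bound m N (trunc_log m.+1 N) <= length_bound m N r.
Proof.
move=> m0 N0; have /andP[] := trunc_log_bounds (m0 : (1 < m.+1)%N) N0.
set k := trunc_log _ _ => kN Nk.
have q0 j : (0 : R) < (m%:R + 1) ^+ j by rewrite exprn_gt0 // natr1.
have up j : (k <= j)%N -> length_bound m N j <= length_bound m N j.+1.
  move=> kj; rewrite -subr_ge0 length_boundS mulr_ge0 // subr_ge0.
  rewrite ler_pdivrMr // mul1r natr1 -natrX ler_nat.
  by apply: leq_trans (ltnW Nk) _; rewrite leq_pexp2l.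
have down j : (j < k)%N -> length_bound m N j.+1 <= length_bound m N j.
  move=> kj; rewrite -subr_le0 length_boundS mulr_ge0_le0 // subr_le0.
  rewrite ler_pdivlMr // mul1r natr1 -natrX ler_nat.
  by apply: leq_trans kN; rewrite leq_pexp2l.
case: (leqP k r) => [kr|rk].
  rewrite -(subnKC kr); elim: (r - k)%N => [|i IH]; first by rewrite addn0.
  by rewrite addnS; apply: le_trans IH (up _ _); rewrite leq_addr.
have hd i : (i <= k)%N -> length_bound m N k <= length_bound m N (k - i).
  elim: i => [|i IH] ik; first by rewrite subn0.
  apply: le_trans (IH (ltnW ik)) _; rewrite -subnSK //.
  by apply: down; lia.
by have := hd _ (leq_subr r k); rewrite subKn // ltnW.
Qed.

(** The summands are compared separately, the first by [2 * m <= n], the second by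
    [n <= 2 * m.+1]. *)
Lemma length_bound_rank (n N r : nat) :
  (N <= n ^ r)%N ->
  length_bound (n %/ 2) N r <= 1 / 2 * (r * n)%:R + 2 ^+ r.
Proof.
move=> Nn; rewrite /length_bound; set m := (n %/ 2)%N.
have q0 j : (0 : R) < (m%:R + 1) ^+ j by rewrite exprn_gt0 // natr1.
have nm : (2 * m <= n <= 2 * m.+1)%N.
  by rewrite /m; have := divn_eq n 2; have := ltn_pmod n (isT : 0 < 2)%N; lia.
apply: lerD.
  have : (2 * (r * m))%:R <= (r * n)%:R :> R.
    by rewrite ler_nat mulnCA leq_mul2l; case/andP: nm => ->; rewrite orbT.
  by rewrite natrM; lra.
rewrite ler_pdivrMr // -exprMn natr1 -natrM -natrX ler_nat.
apply: leq_trans Nn _; case: (posnP r) => [->|r0]; first by rewrite !expn0.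
by rewrite leq_exp2r //; case/andP: nm.
Qed.

End Bounds.

(** * From lengths of [u + v] to the bound on [daleth] *)

Theorem theorem5p4 (R : realType) (H : cmonoidType) (P : choiceType)
    (phi : {additive H -> free_monoid P}) (n r : nat) :
  krull H ->
  cofinal_hom phi ->
  divisor_hom phi ->
  finite_set [set: class_group phi] ->
  (1 < #|` fset_set [set: class_group phi]|)%N ->
  has_exponent (class_group phi) n ->
  has_rank (class_group phi) r ->
  let cardG : nat := #|` fset_set [set: class_group phi]| in
  let D : nat := davenport (prime_classes phi) in
  let m : nat := (n %/ 2)%N in
  let k : nat := trunc_log m.+1 cardG in
  let bound1 : R :=
    Num.max n%:R
      (2 / 3 * D%:R +
       1 / 3 * (Num.floor ((k * m)%:R + cardG%:R * (m%:R + 1) ^- k : R))%:~R) in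
  let bound2 : R :=
    Num.max n%:R (1 / 3 * (2 * D%:R + 1 / 2 * (r * n)%:R + 2 ^+ r)) in
  (daleth H R <= bound1%:E)%E /\ bound1 <= bound2.
Proof.
move=> _ _ divphi fG cG expn rankr cardG D m k bound1 bound2.
have n1 := has_exponent_gt1 fG cG expn.
have nG := has_exponent_torsion expn.
have cardn := has_rank_card fG (ltnW n1) nG rankr.
have m0 : (0 < m)%N by rewrite divn_gt0.
split; last first.
  (* The floor is at most the value at [k], which by minimality is at most the value at [r]. *)
  rewrite /bound1 /bound2 ge_max le_max lexx /= le_max; apply/orP; right.
  rewrite -[X in Num.floor X]/(length_bound R m cardG k).
  have := floor_le (length_bound R m cardG k).
  have := @length_bound_min R m cardG r m0 (ltnW cG).
  have := @length_bound_rank R n cardG r cardn.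
  rewrite -/m -/k; lra.
apply: ge_ereal_sup => _ [l hl <-]; rewrite lee_fin.
case: hl => [->|[[u v] /= [/(atom_zs_atom divphi) au /(atom_zs_atom divphi) av] <-]].
  by rewrite /bound1 le_max ler0n.
(* If 2 is the only length of the sum, the minimum defaults to 0. *)
rewrite /set_min; case: xgetP => [{}l _ [[luv l2] lmin]|_]; last first.
  by rewrite /bound1 le_max ler0n.
have [ws fws sws] := (lengths_zs_factor divphi _ _).1 luv.
rewrite raddfD in fws.
(* Length 0 would make the sum zero, length 1 would make it an atom although it splits, and length 2
   is excluded from the set. *)
have l3 : (2 < size ws)%N.
  have [u0 cu _] := au; have [v0 cv _] := av; have [aws ews] := fws.
  case: ws sws aws ews fws => [|w [|w' [|w'' ws]]] //= sws aws ews fws.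
  - move: ews; rewrite big_nil => /(congr1 (@len P)); rewrite len0 lenD => e.
    by exfalso; apply: u0; apply/eqP; rewrite -len_eq0; lia.
  - move: ews; rewrite big_seq1 => ew.
    have [_ _ hw] := aws _ (mem_head _ _).
    by have [] := hw _ _ ew cu.
  - by case: l2; rewrite /= -sws.
have [prs [sp aprs eu ev]] := two_sided_factor au av l3 fws.
have sf : short_factor (class_of phi) (phi u) (phi v) prs.
  split=> // ws' fws' l3'; rewrite sp sws; apply: lmin; split.
    by apply/(lengths_zs_factor divphi); exists ws' => //; rewrite raddfD.
  by move=> /= e; rewrite e in l3'.
rewrite -sws -sp /bound1 le_max.
case: (leqP (size prs) n) => [ln|nl]; first by rewrite ler_nat ln.
have [j h3 hj] := short_factor_size k fG n1 nG sf nl.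
apply/orP; right.
(* [j] is an integer, so its real upper bound may be replaced by the floor. *)
have jfl : (j%:R : R) <= (Num.floor (length_bound R m cardG k))%:~R.
  rewrite -[j%:R]/((j%:Z)%:~R) ler_int floor_ge_int.
  exact: length_bound_ge.
have h3' : (3 * size prs <= 2 * D + j)%N.
  have := zs_atom_davenport fG au; have := zs_atom_davenport fG av.
  rewrite -/D; lia.
move: h3'; rewrite -(ler_nat R) natrD [(3 * _)%:R]natrM [(2 * D)%:R]natrM.
rewrite -[X in Num.floor X]/(length_bound R m cardG k); lra.
Qed.
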